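(* Let $X$ be a Poisson random variable with mean $m>0$. For real $a,b$, integers $r\ge 0$, and a real-valued function $f$ on the nonnegative integers, put $$C(r,a)=\mathbf{E}(X-a)^r,\qquad D(r,a,b)=\mathbf{E}\big[(X-a)^r\,\mathrm{sign}(X-b)\big],\qquad B(r,a,f)=\mathbf{E}\big[(X-a)^r f(X)\big],$$ where $\mathrm{sign}(y)=-1$ if $y\le 0$ and $\mathrm{sign}(y)=1$ if $y>0$, and $0^0=1$. Let $\Delta f(j)=f(j+1)-f(j)$. Then for all integers $r\ge 1$, all reals $b\ge 0$ and $a$, and all functions $f$ such that $\mathbf{E}\,X^r|f(X)|<\infty$, the following recurrence relations hold: $$C(r,a)=(m-a)\,C(r-1,a)+m\sum_{k=0}^{r-2}\binom{r-1}{k}C(k,a)=m\,C(r-1,a-1)-a\,C(r-1,a),$$ $$D(r,a,b)=(m-a)\,D(r-1,a,b)+m\sum_{k=0}^{r-2}\binom{r-1}{k}D(k,a,b)+2(\lfloor b\rfloor+1-a)^{r-1}e^{-m}\frac{m^{\lfloor b\rfloor+1}}{\lfloor b\rfloor!},$$ $$D(r,a,b)=m\,D(r-1,a-1,b-1)-a\,D(r-1,a,b),$$ $$B(r,a,f)=(m-a)\,B(r-1,a,f)+m\sum_{k=0}^{r-2}\binom{r-1}{k}B(k,a,f)+m\sum_{k=0}^{r-1}\binom{r-1}{k}B(k,a,\Delta f),$$ and all the expectations $B$ appearing in the last relation are finite (i.e. the corresponding random variables are integrable).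
   Context: $X$ is Poisson with mean $m$: $\mathbf{P}(X=j)=e^{-m}m^j/j!$ for $j=0,1,2,\dots$. The sign function is defined with the nonstandard convention $\mathrm{sign}(0)=-1$. The convention $0^0=1$ is used throughout, and empty sums (e.g. $\sum_{k=0}^{r-2}$ when $r=1$) equal $0$. $\lfloor\cdot\rfloor$ is the floor function. *)

(* Defs.v *)
From HB Require Import structures.
From mathcomp Require Import all_boot all_order all_algebra.
From mathcomp Require Import all_classical all_reals all_analysis.

Set Implicit Arguments.
Unset Strict Implicit.
Unset Printing Implicit Defensive.

Import Order.TTheory GRing.Theory Num.Theory.

Local Open Scope classical_set_scope.
Local Open Scope ring_scope.

Definition is_poisson d (T : measurableType d) (R : realType)
    (P : probability T R) (X : {RV P >-> nat}) (m : R) : Prop :=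
  forall j : nat, P (X @^-1` [set j]) = (expR (- m) * m ^+ j / j`!%:R)%:E.

(* Unlike Num.sg, this sign takes the value -1 at 0. *)
Definition sign (R : realType) (y : R) : R := if y <= 0 then -1 else 1.

Definition fdiff (R : realType) (f : nat -> R) (j : nat) : R := f j.+1 - f j.

Section moments.
Context d (T : measurableType d) (R : realType).
Variables (P : probability T R) (X : {RV P >-> nat}).

Definition momC (r : nat) (a : R) : \bar R :=
  ('E_P[fun w : T => (((X w)%:R - a) ^+ r)%R])%E.

Definition momD (r : nat) (a b : R) : \bar R :=
  ('E_P[fun w : T => (((X w)%:R - a) ^+ r * sign ((X w)%:R - b))%R])%E.

Definition momB_rv (r : nat) (a : R) (f : nat -> R) (w : T) : R :=
  ((X w)%:R - a) ^+ r * f (X w).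

Definition momB (r : nat) (a : R) (f : nat -> R) : \bar R :=
  ('E_P[momB_rv r a f])%E.

End moments.

(* Main.v *)
Require Import Defs.
From HB Require Import structures.
From mathcomp Require Import all_boot all_order all_algebra.
From mathcomp Require Import all_classical all_reals all_analysis.
From mathcomp Require Import measurable_realfun.
From mathcomp Require Import ring lra.

Set Implicit Arguments.
Unset Strict Implicit.
Unset Printing Implicit Defensive.

Import Order.TTheory GRing.Theory Num.Theory.

Local Open Scope classical_set_scope.
Local Open Scope ring_scope.
Local Open Scope ereal_scope.

(* The weights satisfy (j+1) P(X = j+1) = m P(X = j), whence the Stein-Chen
   identity E[X h(X)] = m E[h(X+1)]. Writing
   (X-a)^r f(X) = X (X-a)^(r-1) f(X) - a (X-a)^(r-1) f(X), it yields
   B(r,a,f) = m B(r-1,a-1,f(.+1)) - a B(r-1,a,f), which for f = 1 and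
   f = sign(. - b) is the second relation for C and for D. Substituting
   f(.+1) = f + Delta f and expanding (X-(a-1))^(r-1) = (1+(X-a))^(r-1) gives
   the other relations; Delta sign(. - b) is 2 at floor(b) and 0 elsewhere.
   Integrability of the shifted variables also comes from the identity,
   applied to absolute values. *)
Section nat_valued.
Context d (T : measurableType d) (R : realType) (P : probability T R).
Context (X : {RV P >-> nat}).
Implicit Types (g h : nat -> R).

(** * Integrability and means of functions of [X] *)

Definition X_integrable g := P.-integrable setT (EFin \o g \o X).

(** Kept in [R] rather than [\bar R], so that identities between means are closed by [ring];
    meaningful as an expectation under [X_integrable g]. *)
Definition X_mean g : R := (\int[P]_w g (X w))%R.

(** [nat] carries the discrete sigma-algebra, so any [g] will do. *)
Lemma measurable_comp_nat g : measurable_fun setT (EFin \o g \o X).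
Proof.
apply/measurable_EFinP.
by apply: (@measurableT_comp _ _ _ _ _ _ g) => // _ Y mY; rewrite setTI.
Qed.

Lemma X_integrableP g :
  X_integrable g <-> \int[P]_w `|g (X w)|%:E < +oo.
Proof.
split; first by case/integrableP => _.
by move=> g_fin; apply/integrableP; split => //; exact: measurable_comp_nat.
Qed.

Lemma X_integrable_abs g : X_integrable g -> X_integrable (fun j => `|g j|%R).
Proof. by move/X_integrableP => ?; apply/X_integrableP; under eq_integral do rewrite normr_id. Qed.

Lemma expectation_X_mean g : X_integrable g ->
  'E_P[fun w => g (X w)] = (X_mean g)%:E.
Proof. by move=> gi; rewrite unlock /X_mean /Rintegral fineK// integrable_fin_num. Qed.

Lemma le_X_integrable g h : (forall j, `|g j| <= h j)%R ->
  X_integrable h -> X_integrable g.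
Proof.
move=> gh; apply: le_integrable => //; first exact: measurable_comp_nat.
by move=> w _ /=; rewrite lee_fin (le_trans (gh _))// ler_norm.
Qed.

Lemma X_integrableD g h : X_integrable g -> X_integrable h ->
  X_integrable (fun j => g j + h j)%R.
Proof. by move=> gi hi; exact: (integrableD measurableT gi hi). Qed.

Lemma X_integrableZ (k : R) g : X_integrable g -> X_integrable (fun j => k * g j)%R.
Proof. by move=> gi; exact: (integrableZl measurableT k gi). Qed.

Lemma X_integrableB g h : X_integrable g -> X_integrable h ->
  X_integrable (fun j => g j - h j)%R.
Proof. by move=> gi hi; exact: (integrableB measurableT gi hi). Qed.

Lemma X_meanD g h : X_integrable g -> X_integrable h ->
  X_mean (fun j => g j + h j)%R = (X_mean g + X_mean h)%R.
Proof. by move=> gi hi; exact: RintegralD. Qed.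

Lemma X_meanB g h : X_integrable g -> X_integrable h ->
  X_mean (fun j => g j - h j)%R = (X_mean g - X_mean h)%R.
Proof. by move=> gi hi; exact: RintegralB. Qed.

Lemma X_meanZ (k : R) g : X_integrable g ->
  X_mean (fun j => k * g j)%R = (k * X_mean g)%R.
Proof. by move=> gi; exact: RintegralZl. Qed.

Lemma X_integrable_sum n (h : nat -> nat -> R) :
  (forall k, (k < n)%N -> X_integrable (h k)) ->
  X_integrable (fun j => \sum_(0 <= k < n) h k j)%R.
Proof.
elim: n => [|n IHn] hi.
  by under [fun j : nat => _]eq_fun do rewrite big_nil; exact: integrable0.
under [fun j : nat => _]eq_fun do rewrite big_nat_recr//=.
apply: X_integrableD; last exact: hi.
by apply: IHn => k kn; apply: hi; exact: ltnW.
Qed.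

Lemma X_mean_sum n (h : nat -> nat -> R) :
  (forall k, (k < n)%N -> X_integrable (h k)) ->
  X_mean (fun j => \sum_(0 <= k < n) h k j)%R = (\sum_(0 <= k < n) X_mean (h k))%R.
Proof.
elim: n => [|n IHn] hi.
  rewrite big_nil; under [fun j : nat => _]eq_fun do rewrite big_nil.
  by rewrite -[RHS]/(fine 0); congr fine; exact: integral0.
have hi' k : (k < n)%N -> X_integrable (h k) by move/ltnW; exact: hi.
under [fun j : nat => _]eq_fun do rewrite big_nat_recr//=.
rewrite X_meanD; [|exact: X_integrable_sum|exact: hi].
by rewrite IHn// big_nat_recr.
Qed.

(** The fibres of [X] partition the space, and the integrand is constant on each. *)
Lemma ge0_integral_comp_nat g : (forall j, 0 <= g j)%R ->
  \int[P]_w (g (X w))%:E = \sum_(j <oo) (g j)%:E * P (X @^-1` [set j]).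
Proof.
move=> g0; have mX j : measurable (X @^-1` [set j]).
  by rewrite -[X @^-1` _]setTI; exact: measurable_funP.
have -> : [set: T] = \bigcup_j (X @^-1` [set j]).
  by apply/seteqP; split => // w _; exists (X w).
rewrite ge0_integral_bigcup//; last 3 first.
- exact/measurable_funTS/measurable_comp_nat.
- by move=> w _; rewrite lee_fin.
- apply/trivIsetP => i j _ _ ij; apply/seteqP; split => // w [/= Xi Xj].
  by move: ij; rewrite -Xi -Xj eqxx.
apply: eq_eseriesr => j _; rewrite -integral_cst//.
by apply: eq_integral => w; rewrite inE /= => ->.
Qed.

Lemma X_integrable_cst (c : R) : X_integrable (fun=> c).
Proof. exact: (finite_measure_integrable_cst P c). Qed.

Lemma X_mean_point n g :
  X_mean (fun j => if j == n then g j else 0)%R =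
  (g n * fine (P (X @^-1` [set n])))%R.
Proof.
pose i j : R := (j == n)%:R.
have ii : X_integrable i.
  apply: le_X_integrable (X_integrable_cst 1) => j.
  by rewrite /i normr_nat lern1 leq_b1.
have -> : (fun j => if j == n then g j else 0)%R = (fun j => g n * i j)%R.
  by apply/funext => j; rewrite /i; case: eqP => [->|_]; rewrite ?mulr1 ?mulr0.
rewrite X_meanZ//; congr (_ * _)%R.
have mX : measurable (X @^-1` [set n]).
  by rewrite -[X @^-1` _]setTI; exact: measurable_funP.
rewrite /X_mean /Rintegral -(expectation_indic P mX) unlock.
congr fine; apply: eq_integral => w _; rewrite indicE /i; congr (nat_of_bool _)%:R%:E.
by apply/idP/idP => [/eqP <-|]; rewrite inE// => /eqP.
Qed.

(** * Centered powers: domination and binomial expansion *)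

Definition centered (k : nat) (a : R) g (j : nat) : R := ((j%:R - a) ^+ k * g j)%R.

(** For [j >= 1], [|j - a| <= (1 + |a|) * j] and [j ^ k <= j ^ s]. The point [0] is dominated
    separately by [|g 0|], since [j ^ s * g j] vanishes there when [s > 0]. *)
Lemma X_integrable_centered s k a g : (k <= s)%N ->
  X_integrable (fun j => j%:R ^+ s * g j)%R -> X_integrable (centered k a g).
Proof.
move=> ks gi; pose c : R := ((1 + `|a|) ^+ k)%R.
apply: (@le_X_integrable _ (fun j => c * (`|g 0%N| + `|j%:R ^+ s * g j|))%R); last first.
  apply/X_integrableZ/X_integrableD; first exact: X_integrable_cst.
  exact: X_integrable_abs.
have c0 : (0 <= c)%R by rewrite exprn_ge0// addr_ge0.
move=> [|j]; rewrite /centered normrM normrX.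
  rewrite sub0r normrN ler_pM ?exprn_ge0//; last by rewrite lerDl.
  by rewrite lerXn2r ?nnegrE ?addr_ge0// lerDr.
apply: (@le_trans _ _ (c * `|j.+1%:R ^+ s * g j.+1|)%R); last first.
  by rewrite ler_wpM2l// lerDr.
rewrite [in leRHS]normrM mulrA ler_wpM2r// [in leRHS]normrX normr_nat.
apply: (@le_trans _ _ (c * j.+1%:R ^+ k)%R); last first.
  by rewrite ler_wpM2l// ler_weXn2l// ler1n.
rewrite -exprMn lerXn2r ?nnegrE ?mulr_ge0 ?addr_ge0//.
rewrite (le_trans (ler_normB _ _))// normr_nat mulrDl mul1r lerD2l.
by rewrite ler_peMr// ler1n.
Qed.

Lemma centered_binomial s a g :
  centered s (a - 1)%R g =
  (fun j => \sum_(0 <= k < s.+1) 'C(s, k)%:R * centered k a g j)%R.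
Proof.
apply/funext => j; rewrite /centered opprB addrCA exprDn big_mkord mulr_suml.
by apply: eq_bigr => k _; rewrite expr1n mul1r -mulr_natl mulrA.
Qed.

Lemma X_mean_centered_binomial s a g :
  X_integrable (fun j => j%:R ^+ s * g j)%R ->
  X_mean (centered s (a - 1)%R g) =
  (\sum_(0 <= k < s.+1) 'C(s, k)%:R * X_mean (centered k a g))%R.
Proof.
move=> gi; have ci k : (k < s.+1)%N -> X_integrable (centered k a g).
  by move=> ks; exact: X_integrable_centered gi.
rewrite centered_binomial X_mean_sum => [|k ks]; last exact/X_integrableZ/ci.
by apply: eq_big_nat => k /ci; exact: X_meanZ.
Qed.

Lemma momBE k a g : X_integrable (centered k a g) ->
  momB X k a g = (X_mean (centered k a g))%:E.
Proof. exact: expectation_X_mean. Qed.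

Lemma momB_binomial s a g : X_integrable (fun j => j%:R ^+ s * g j)%R ->
  momB X s (a - 1)%R g = \sum_(0 <= k < s.+1) 'C(s, k)%:R%:E * momB X k a g.
Proof.
move=> gi; rewrite momBE; last exact: X_integrable_centered (leqnn s) gi.
rewrite X_mean_centered_binomial// -sumEFin; apply: eq_big_nat => k /= ks.
by rewrite momBE//; exact: X_integrable_centered gi.
Qed.

Lemma momCE k a : momC X k a = momB X k a (fun=> 1%R).
Proof.
by congr expectation; apply/funext => w; rewrite /momB_rv mulr1.
Qed.

End nat_valued.

(** * The Stein-Chen identity for the Poisson law *)

Section poisson.
Context d (T : measurableType d) (R : realType) (P : probability T R).
Context (X : {RV P >-> nat}) (m : R).
Hypotheses (m_gt0 : (0 < m)%R) (X_poisson : is_poisson X m).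
Implicit Types (f g h : nat -> R).

Local Notation X_integrable := (X_integrable X).
Local Notation X_mean := (X_mean X).

(** Both sides may be [+oo], so this form can also decide integrability. *)
Lemma ge0_poisson_shift h : (forall j, 0 <= h j)%R ->
  \int[P]_w ((X w)%:R * h (X w))%:E = m%:E * \int[P]_w (h (X w).+1)%:E.
Proof.
move=> h0; rewrite (ge0_integral_comp_nat X (g := fun j => (j%:R * h j)%R)); last first.
  by move=> j; rewrite mulr_ge0.
rewrite (ge0_integral_comp_nat X (g := fun j => h j.+1))//.
have P0 j x : (0 <= x)%R -> 0 <= x%:E * P (X @^-1` [set j]).
  by move=> x0; rewrite mule_ge0// lee_fin.
(* The term [j = 0] vanishes through its factor [j]; the others are reindexed to match the
   right-hand side term by term. *)
rewrite nneseries_recl => // [|j _]; last by rewrite P0// mulr_ge0.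
rewrite mul0r mul0e add0e -nneseriesZl => [|j _]; last exact: P0.
rewrite -nneseries_addn => [|j]; last by rewrite P0// mulr_ge0.
apply: eq_eseriesr => j _; rewrite addn1 !X_poisson -!EFinM factS natrM exprS.
congr EFin; field.
by rewrite nat1r !pnatr_eq0 -lt0n fact_gt0.
Qed.

Lemma X_integrable_shift h : X_integrable (fun j => j%:R * h j)%R <->
  X_integrable (fun j => h j.+1).
Proof.
rewrite !X_integrableP; under eq_integral do rewrite normrM normr_nat.
rewrite (ge0_poisson_shift (h := fun j => `|h j|%R))//.
set I := \int[P]_w `|h (X w).+1|%:E; have I0 : 0 <= I by exact: integral_ge0.
(* As [m > 0], the product [m * I] is finite exactly when [I] is. *)
case: I I0 => [x|_|//]; first by rewrite -EFinM !ltry; split.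
by rewrite gt0_muley ?lte_fin// ltxx; split.
Qed.

Lemma poisson_shift h : X_integrable (fun j => h j.+1) ->
  X_mean (fun j => j%:R * h j)%R = (m * X_mean (fun j => h j.+1))%R.
Proof.
move=> hi; have ai := X_integrable_abs hi.
(* Both [|h|] and [n] are nonnegative and [h = |h| - n], so linearity reduces the claim to the
   nonnegative case. *)
pose n j := (`|h j| - h j)%R.
have hE j : h j = (`|h j| - n j)%R by rewrite /n subKr.
have shift0 k : (forall j, 0 <= k j)%R -> X_integrable (fun j => k j.+1) ->
    X_mean (fun j => j%:R * k j)%R = (m * X_mean (fun j => k j.+1))%R.
  move=> k0 ki; rewrite /X_mean /Rintegral ge0_poisson_shift// fineM//.
  exact: integrable_fin_num.
under [fun j : nat => (_ * _)%R]eq_fun do rewrite hE mulrBr.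
under [fun j : nat => h _]eq_fun do rewrite hE.
have ni : X_integrable (fun j => n j.+1) by exact: X_integrableB.
rewrite [LHS]X_meanB; last 2 first.
- exact/(X_integrable_shift (fun j => `|h j|%R)).
- exact/X_integrable_shift.
rewrite [X in (_ * X)%R]X_meanB// mulrBr (shift0 (fun j => `|h j|%R))// shift0// => j.
by rewrite subr_ge0 ler_norm.
Qed.

(** By induction: the shift turns [j * j ^ s] into [(j + 1) ^ s], a power centered at [-1]. The
    factor [1] presents the function in the form [j ^ s * g j] with [g] constant. *)
Lemma X_integrable_exp s : X_integrable (fun j => j%:R ^+ s * 1)%R.
Proof.
elim: s => [|s IHs].
  by under [fun j : nat => _]eq_fun do rewrite mulr1; exact: X_integrable_cst.
under [fun j : nat => _]eq_fun do rewrite exprS -mulrA.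
rewrite X_integrable_shift; apply: le_X_integrable (X_integrable_abs
  (X_integrable_centered (- 1) (leqnn s) IHs)) => j.
by rewrite /centered opprK -natr1.
Qed.

(** The shift gives integrability of [(j + 1) ^ s * f (j + 1)], which dominates. *)
Lemma X_integrable_exp_shift s f :
  X_integrable (fun j => j%:R ^+ s.+1 * f j)%R ->
  X_integrable (fun j => j%:R ^+ s * f j.+1)%R.
Proof.
under [fun j : nat => _]eq_fun do rewrite exprS -mulrA.
rewrite X_integrable_shift => /X_integrable_abs; apply: le_X_integrable => j.
by rewrite !normrM ler_wpM2r// !normrX !normr_nat lerXn2r ?nnegrE// ler_nat.
Qed.

(** * Recurrences for real means *)

Lemma X_mean_centeredS s a f :
  X_integrable (fun j => j%:R ^+ s.+1 * f j)%R ->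
  X_mean (centered s.+1 a f) =
  (m * X_mean (centered s (a - 1)%R (f \o succn)) - a * X_mean (centered s a f))%R.
Proof.
move=> fi; have ci : X_integrable (centered s a f).
  exact: X_integrable_centered (leqnSn s) fi.
(* Since [(j + 1) - a = j - (a - 1)], shifting the index moves the center. *)
have shiftE : (fun j => centered s a f j.+1) = centered s (a - 1)%R (f \o succn).
  by apply/funext => j; rewrite /centered/= -natr1 opprB addrA addrAC.
have si : X_integrable (fun j => centered s a f j.+1).
  rewrite shiftE; apply: X_integrable_centered (leqnn s) _.
  exact: X_integrable_exp_shift.
rewrite -shiftE -poisson_shift// -X_meanZ// -X_meanB; last 2 first.
- exact/X_integrable_shift.
- exact: X_integrableZ.
by congr X_mean; apply/funext => j; rewrite /centered exprS; ring.
Qed.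

Lemma X_integrable_fdiff s f :
  X_integrable (fun j => j%:R ^+ s.+1 * f j)%R ->
  X_integrable (fun j => j%:R ^+ s * fdiff f j)%R.
Proof.
move=> fi; under [fun j : nat => _]eq_fun do rewrite mulrBr.
apply: X_integrableB; first exact: X_integrable_exp_shift.
(* With center [0] this merely lowers the exponent from [s + 1] to [s]. *)
have := X_integrable_centered 0 (leqnSn s) fi.
by rewrite /centered; under [fun j : nat => _]eq_fun do rewrite subr0.
Qed.

(** The difference term stays centered at [a - 1], unexpanded: it vanishes for C, is a point
    evaluation for D, and is expanded only for B. *)
Lemma X_mean_centered_fdiff s a f :
  X_integrable (fun j => j%:R ^+ s.+1 * f j)%R ->
  X_mean (centered s.+1 a f) =
  ((m - a) * X_mean (centered s a f)
   + m * \sum_(0 <= k < s) 'C(s, k)%:R * X_mean (centered k a f)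
   + m * X_mean (centered s (a - 1) (fdiff f)))%R.
Proof.
move=> fi; have fi' : X_integrable (fun j => j%:R ^+ s * f j)%R.
  have := X_integrable_centered 0 (leqnSn s) fi.
  by rewrite /centered; under [fun j : nat => _]eq_fun do rewrite subr0.
have -> : X_mean (centered s.+1 a f) = (m * (X_mean (centered s (a - 1) f)
    + X_mean (centered s (a - 1) (fdiff f))) - a * X_mean (centered s a f))%R.
  rewrite X_mean_centeredS// -X_meanD; last 2 first.
  - exact: X_integrable_centered (leqnn s) _.
  - exact: X_integrable_centered (leqnn s) (X_integrable_fdiff _).
  congr (_ * X_mean _ - _)%R; apply/funext => j.
  by rewrite /centered /fdiff/=; ring.
(* The top term [k = s], of coefficient [1], joins the term in [- a] to give the factor [m - a]. *)
rewrite X_mean_centered_binomial// big_nat_recr//= binn.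
by ring.
Qed.

(** * Transfer to the extended-real moments *)

Lemma momBS s a f : X_integrable (fun j => j%:R ^+ s.+1 * f j)%R ->
  momB X s.+1 a f =
  m%:E * momB X s (a - 1)%R (fun j => f j.+1) - a%:E * momB X s a f.
Proof.
move=> fi; rewrite !momBE ?X_mean_centeredS//.
- exact: X_integrable_centered (leqnSn s) fi.
- exact: X_integrable_centered (leqnn s) (X_integrable_exp_shift fi).
- exact: X_integrable_centered (leqnn s.+1) fi.
Qed.

Lemma momB_fdiff s a f : X_integrable (fun j => j%:R ^+ s.+1 * f j)%R ->
  momB X s.+1 a f = (m - a)%:E * momB X s a f
    + m%:E * \sum_(0 <= k < s) 'C(s, k)%:R%:E * momB X k a f
    + m%:E * momB X s (a - 1)%R (fdiff f).
Proof.
move=> fi; have ci k : (k <= s.+1)%N -> X_integrable (centered k a f).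
  by move=> ks; exact: X_integrable_centered ks fi.
under eq_big_nat => k /andP[_ /ltnW/leqW/ci ?] do rewrite momBE// -EFinM.
rewrite sumEFin !momBE ?X_mean_centered_fdiff//.
- exact: X_integrable_centered (leqnn s) (X_integrable_fdiff fi).
- exact/ci/leqnSn.
- exact: ci.
Qed.

End poisson.

(** The sign jumps between [j] and [j + 1] exactly when [j <= b < j + 1]; the value [-1] at [0]
    makes this hold for integer [b] too. *)
Lemma fdiff_sign (R : realType) (b : R) : (0 <= b)%R ->
  fdiff (fun j => sign (j%:R - b)) =
  (fun j => if j == `|Num.floor b|%N then 2 else 0)%R.
Proof.
move=> b0; apply/funext => j; rewrite /fdiff /sign !subr_le0.
have fb : (0 <= Num.floor b)%R by rewrite floor_ge_int.
have -> : (j == `|Num.floor b|%N) = (Num.floor b == j%:Z).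
  by rewrite -[in RHS](gez0_abs fb) eqz_nat eq_sym.
rewrite floor_eq intrD -!pmulrn -natrD addn1.
have jj : (j%:R < j.+1%:R :> R)%R by rewrite ltr_nat.
by case: (leP j%:R%R b); case: (leP j.+1%:R%R b) => /= ? ?; lra.
Qed.

(** * Specialisation to C, D and B *)

Theorem theorem1 (d : measure_display) (T : measurableType d) (R : realType)
    (P : probability T R) (X : {RV P >-> nat}) (m : R)
    (m_gt0 : (0 < m)%R) (X_poisson : is_poisson X m)
    (r : nat) (r_ge1 : (1 <= r)%N) (a b : R) (b_ge0 : (0 <= b)%R)
    (f : nat -> R)
    (f_fin : 'E_P[fun w : T => ((X w)%:R ^+ r * `|f (X w)|)%R] < +oo) :
  (momC X r a = (m - a)%:E * momC X r.-1 a
      + m%:E * \sum_(0 <= k < r.-1) ('C(r.-1, k)%:R)%:E * momC X k a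
   /\ momC X r a = m%:E * momC X r.-1 (a - 1)%R - a%:E * momC X r.-1 a)
  /\
  momD X r a b = (m - a)%:E * momD X r.-1 a b
      + m%:E * \sum_(0 <= k < r.-1) ('C(r.-1, k)%:R)%:E * momD X k a b
      + (2 * ((Num.floor b)%:~R + 1 - a) ^+ r.-1 * expR (- m)
         * (m ^+ (`|Num.floor b|%N).+1 / (`|Num.floor b|%N)`!%:R))%:E
  /\
  momD X r a b = m%:E * momD X r.-1 (a - 1)%R (b - 1)%R - a%:E * momD X r.-1 a b
  /\
  momB X r a f = (m - a)%:E * momB X r.-1 a f
      + m%:E * \sum_(0 <= k < r.-1) ('C(r.-1, k)%:R)%:E * momB X k a f
      + m%:E * \sum_(0 <= k < r) ('C(r.-1, k)%:R)%:E * momB X k a (fdiff f)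
  /\
  (forall k : nat, (k <= r)%N ->
     P.-integrable setT (EFin \o momB_rv X k a f))
  /\
  (forall k : nat, (k <= r.-1)%N ->
     P.-integrable setT (EFin \o momB_rv X k a (fdiff f))).
Proof.
case: r r_ge1 f_fin => // s _ f_fin; rewrite succnK.
have fi : X_integrable X (fun j => j%:R ^+ s.+1 * f j)%R.
  apply/X_integrableP; move: f_fin; rewrite unlock.
  by under eq_integral do rewrite -[X in (X * _)%R]ger0_norm ?exprn_ge0// -normrM.
have onei := X_integrable_exp m_gt0 X_poisson.
pose sgn := fun (c : R) (j : nat) => sign (j%:R - c).
(* As [|sign| = 1], the finite Poisson moments suffice. *)
have sgni k : X_integrable X (fun j => j%:R ^+ k * sgn b j)%R.
  apply: le_X_integrable (X_integrable_abs (onei k)) => j.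
  rewrite !normrM ler_wpM2l// normr1 /sgn /sign.
  by case: ifP; rewrite ?normrN normr1.
have momDE k c e : momD X k c e = momB X k c (sgn e) by [].
split; first split.
- rewrite !momCE (momB_fdiff m_gt0 X_poisson)//.
  (* The difference of the constant [1] is zero. *)
  rewrite [X in _ + _ * X](_ : _ = 0) ?mule0 ?adde0.
    by under [in RHS]eq_bigr do rewrite momCE.
  rewrite /momB unlock; apply: integral0_eq => w _.
  by rewrite /momB_rv /fdiff subrr mulr0.
- by rewrite !momCE (momBS m_gt0 X_poisson).
split.
- rewrite !momDE (momB_fdiff m_gt0 X_poisson)//; congr (_ + _).
  rewrite momBE; last first.
    apply: X_integrable_centered (leqnn s) _.
    exact: (X_integrable_fdiff m_gt0 X_poisson).
  (* Only [j = n] contributes, where the center [a - 1] produces the base [n + 1 - a]. *)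
  set n := `|Num.floor b|%N.
  have -> : centered s (a - 1)%R (fdiff (sgn b)) =
      (fun j => if j == n then ((j%:R + 1 - a) ^+ s * 2)%R else 0%R).
    apply/funext => j; rewrite /centered fdiff_sign//.
    by case: ifP; rewrite ?mulr0// opprB addrA.
  rewrite (X_mean_point X n (fun j => (j%:R + 1 - a) ^+ s * 2)%R) X_poisson -EFinM.
  rewrite [n%:R%R](_ : _ = (Num.floor b)%:~R); last first.
    by rewrite pmulrn gez0_abs// floor_ge_int.
  congr EFin; rewrite /= exprS; ring.
split.
  rewrite !momDE (momBS m_gt0 X_poisson)//.
  (* Shifting the index inside the sign replaces [b] by [b - 1]. *)
  congr (_ * momB X _ _ _ - _).
  by apply/funext => j; rewrite /sgn -natr1 opprB addrA.
split.
  (* The binomial expansion brings the difference term back from center [a - 1] to center [a]. *)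
  rewrite (momB_fdiff m_gt0 X_poisson)// (momB_binomial (s := s))//.
  exact: (X_integrable_fdiff m_gt0 X_poisson).
split=> k ks.
  exact: X_integrable_centered ks fi.
exact: X_integrable_centered ks (X_integrable_fdiff m_gt0 X_poisson fi).
Qed.
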